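(* Given positive integers $b_1 < b_2 < \cdots < b_k$ with $\gcd(b_1, b_2, \ldots, b_k) = 1$ (encoded in binary), one can compute in time polynomial in the input size integers $h, a_1 = 1, a_2, \ldots, a_k, a_{k+1}, a_{k+2}$ such that $$g(b_1, b_2, \ldots, b_k) = h\, a_{k+2} - N_h(a_1, a_2, \ldots, a_k, a_{k+1}, a_{k+2}).$$
   Context: For positive integers $b_1, \ldots, b_m$ with $\gcd(b_1, \ldots, b_m) = 1$, the Frobenius number $g(b_1, \ldots, b_m)$ is the largest integer that cannot be written as a non-negative integer linear combination $\sum_{i=1}^m x_i b_i$. For positive integers $a_1 = 1 < a_2 < \cdots < a_n$ and an integer $h \geq 1$, $N_h(a_1, \ldots, a_n)$ denotes the smallest positive integer that cannot be written as $\sum_{i=1}^n x_i a_i$ with all $x_i$ non-negative integers and $\sum_{i=1}^n x_i \leq h$. *)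

(* Defs.v *)
From HB Require Import structures.
From mathcomp Require Import all_boot all_order all_algebra.

Set Implicit Arguments.
Unset Strict Implicit.
Unset Printing Implicit Defensive.

(** * Deterministic multi-tape Turing machines *)

(* The input/output alphabet: [Some b] is the bit [b], [None] is a separator. *)
Definition io := option bool.

(* Tape symbols: [None] is the blank, [K] holds the machine's own extra work
   symbols. *)
Definition symbol (K : finType) := option (io + K).

Inductive move := MoveL | Stay | MoveR.

(* There are [ntapes.+1] tapes; tape [ord0] is the input tape and tape [ord_max]
   is the output tape. *)
Record TM := MkTM {
  state : finType;
  work : finType;
  ntapes : nat;
  start : state;
  final : pred state;
  delta : state -> ntapes.+1.-tuple (symbol work) ->
          state * ntapes.+1.-tuple (symbol work * move) }.

(* A two-way infinite tape, blank outside of the listed cells: the cells to the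
   left of the head (nearest first), the scanned cell, and the cells to its
   right (nearest first). *)
Record tape (K : finType) := MkTape {
  tleft : seq (symbol K);
  tcur : symbol K;
  tright : seq (symbol K) }.

Definition move_tape (K : finType) (d : move) (t : tape K) : tape K :=
  let: MkTape l c r := t in
  match d with
  | MoveL => MkTape (behead l) (head None l) (c :: r)
  | Stay => t
  | MoveR => MkTape (c :: l) (head None r) (behead r)
  end.

Definition write_move (K : finType) (t : tape K) (a : symbol K * move) : tape K :=
  move_tape a.2 (MkTape (tleft t) a.1 (tright t)).

Definition config (M : TM) := (state M * (ntapes M).+1.-tuple (tape (work M)))%type.

Definition step (M : TM) (c : config M) : config M :=
  if final c.1 then c else
  let: (q, acts) := delta c.1 [tuple tcur (tnth c.2 i) | i < (ntapes M).+1] in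
  (q, [tuple write_move (tnth c.2 i) (tnth acts i) | i < (ntapes M).+1]).

Definition blank_tape (K : finType) : tape K := MkTape [::] None [::].

Definition word_cells (K : finType) (w : seq io) : seq (symbol K) :=
  [seq Some (inl x) | x <- w].

(* The head scans the first letter of [w]. *)
Definition word_tape (K : finType) (w : seq io) : tape K :=
  MkTape [::] (head None (word_cells K w)) (behead (word_cells K w)).

Definition init (M : TM) (w : seq io) : config M :=
  (start M, [tuple if i == ord0 then word_tape (work M) w else blank_tape (work M)
            | i < (ntapes M).+1]).

(* The tape holds [w], surrounded by blanks; the head may be anywhere. *)
Definition holds_word (K : finType) (t : tape K) (w : seq io) : Prop :=
  exists i j : nat,
    rev (tleft t) ++ tcur t :: tright t
      = nseq i None ++ word_cells K w ++ nseq j None.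

Definition computes_within (M : TM) (w : seq io) (t : nat) (w' : seq io) : Prop :=
  let c := iter t (@step M) (init M w) in
  final c.1 /\ holds_word (tnth c.2 ord_max) w'.

(** * Binary encoding and polynomial time *)

(* Binary expansion without leading zeros, least significant bit first; 0 is
   written with the single bit 0. *)
Definition bits (n : nat) : seq bool :=
  mkseq (fun i => odd (n %/ 2 ^ i)) (trunc_log 2 n).+1.

(* Every number is followed by a separator. *)
Definition encode (s : seq nat) : seq io :=
  flatten [seq rcons [seq Some b | b <- bits n] None | n <- s].

(* [f] is only required to be computed on inputs satisfying [D]; the running
   time is measured in the length of the binary encoding. *)
Definition polytime_computable (D : seq nat -> Prop) (f : seq nat -> seq nat) : Prop :=
  exists (M : TM) (p : {poly nat}), forall s : seq nat, D s ->
    exists2 t : nat, t <= p.[size (encode s)]%R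
                   & computes_within M (encode s) t (encode (f s)).

(** * Frobenius numbers and postage stamps *)

Definition frobenius_input (b : seq nat) : Prop :=
  [/\ all (fun x => 0 < x) b, sorted ltn b & \big[gcdn/0]_(x <- b) x = 1].

Definition representable (b : seq nat) (m : int) : Prop :=
  exists x : 'I_(size b) -> nat, m = Posz (\sum_(i < size b) x i * nth 0 b i).

Definition frobenius_number (b : seq nat) (g : int) : Prop :=
  ~ representable b g /\
  (forall m : int, ~ representable b m -> (m <= g)%R).

Definition stamp_representable (h : nat) (a : seq nat) (m : nat) : Prop :=
  exists x : 'I_(size a) -> nat,
    m = \sum_(i < size a) x i * nth 0 a i /\ \sum_(i < size a) x i <= h.

Definition stamp_number (h : nat) (a : seq nat) (N : nat) : Prop :=
  [/\ 0 < N, ~ stamp_representable h a N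
    & forall m : nat, 0 < m -> ~ stamp_representable h a m -> N <= m].

(* Main.v *)
Require Import Defs.
From HB Require Import structures.
From mathcomp Require Import all_boot all_order all_algebra zify.
From Stdlib Require Import Classical.

Set Implicit Arguments.
Unset Strict Implicit.
Unset Printing Implicit Defensive.

(** Let [L] be the length of the encoding of [b], [A = 2^L - 1], [h = 4^L - 1],
    and take the stamps [1], [A - b_k], ..., [A - b_1], [A].  Replacing each of
    [h] (possibly void) stamps [c] by [A - c] turns a stamp sum [m] into a sum
    [h A - m] of at most [h] coins among [b_1, ..., b_k, A - 1, A].  Both [A - 1]
    and [A] exceed the Frobenius number [g], so [h A - g] is not a stamp sum.
    Conversely, [m < h A - g] is reached with stamps [1] and [A] alone unless
    [n = h A - m] is at most [(A - 2) A <= h], and then [n > g] is a sum of at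
    most [n <= h] of the [b_i].  The bound [g < A - 1] comes from reducing all
    coefficients but the first modulo [b_1].

    Since [A] is all ones in binary, [A - b_i] is the bitwise complement of [b_i]
    padded with ones to [L] digits, which makes the Turing machine short. *)

(** * Coin sums *)

(** A list of coins rather than multiplicities, so that complements can be taken coin by coin. *)
Definition coin_sum (a : seq nat) (c m : nat) : Prop :=
  exists s : seq nat, [/\ all (mem a) s, sumn s = m & size s = c].

Lemma coin_sumP (a : seq nat) (c m : nat) :
  coin_sum a c m <-> exists x : 'I_(size a) -> nat,
    m = \sum_(i < size a) x i * nth 0 a i /\ \sum_(i < size a) x i = c.
Proof.
split=> [[s [+ <- <-]]|[x [-> <-]]].
  elim: s => [_|y s IHs /= /andP[ya /IHs[x [-> <-]]]].
    by exists (fun=> 0); rewrite !big1.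
  have iy : index y a < size a by rewrite index_mem.
  exists (fun i => x i + (i == Ordinal iy)); split; last first.
    rewrite big_split /= (bigD1 (Ordinal iy) (F := fun i => nat_of_bool (i == _))) //=.
    by rewrite eqxx [X in _ + (_ + X)]big1 ?addn0 ?addn1 // => i /negPf->.
  under eq_bigr => i _ do rewrite mulnDl.
  rewrite big_split /= [X in _ = _ + X](bigD1 (Ordinal iy)) //= eqxx mul1n nth_index //.
  by rewrite [X in _ + (_ + X)]big1 ?addn0 1?addnC // => i /negPf->.
elim/big_rec2: _ => [|i c' m' _ [s [sa <- <-]]]; first by exists [::].
exists (nseq (x i) (nth 0 a i) ++ s).
rewrite all_cat sa all_nseq inE mem_nth // orbT sumn_cat sumn_nseq size_cat size_nseq mulnC.
by split.
Qed.

Lemma representableP (b : seq nat) (n : nat) :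
  representable b (Posz n) <-> exists c, coin_sum b c n.
Proof.
split=> [[x [->]]|[c /coin_sumP[x [-> _]]]]; last by exists x.
by exists (\sum_i x i); apply/coin_sumP; exists x.
Qed.

Lemma stamp_representableP (h : nat) (a : seq nat) (m : nat) :
  stamp_representable h a m <-> exists2 c, c <= h & coin_sum a c m.
Proof.
split=> [[x [-> le_h]]|[c le_h /coin_sumP[x [-> xc]]]].
  by exists (\sum_i x i) => //; apply/coin_sumP; exists x.
by exists x; rewrite xc.
Qed.

(** Induction on [b]: by Bezout, adding a multiple of [y] to [n] makes it divisible by the gcd of
    [x] and the remaining coins. The multiple is cancelled by copies of [y], whose number may be
    reduced modulo [x], so each coin is used at most [x.-1] times. *)
Lemma coin_sum_mod (x : nat) (b : seq nat) (n : nat) : 0 < x ->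
  gcdn x (\big[gcdn/0]_(y <- b) y) %| n ->
  exists c m, [/\ coin_sum b c m, m = n %[mod x] & m <= x.-1 * sumn b].
Proof.
move=> x_gt0; elim: b n => [|y b IHb] n.
  rewrite big_nil gcdn0 => /dvdnP[q ->]; exists 0, 0; split; last by [].
    by exists [::].
  by rewrite modnMl mod0n.
rewrite big_cons gcdnCA; set g := gcdn x _ => /dvdnP[q def_n].
have g_gt0 : 0 < g by rewrite gcdn_gt0 x_gt0.
have [a _ ga] := Bezoutl y g_gt0.
have /IHb[c [m [[s [sb <- _]] sm le_m]]] : g %| n + a * q * y.
  by rewrite def_n mulnAC [a * y * q]mulnC -mulnDr gcdnC dvdn_mull.
(* Here [x.-1] stands for -1 modulo [x]: [u] copies of [y] cancel [a * q * y]. *)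
pose u := (x.-1 * a * q) %% x.
have lt_u : u < x by rewrite ltn_mod.
exists (u + size s), (u * y + sumn s); split.
- exists (nseq u y ++ s); rewrite all_cat all_nseq /= inE eqxx orbT /=.
  rewrite sumn_cat sumn_nseq size_cat size_nseq mulnC; split=> //.
  by apply: sub_all sb => z /= zb; rewrite inE zb orbT.
- rewrite -modnDmr sm modnDmr -modnDml modnMml modnDml.
  have -> : x.-1 * a * q * y + (n + a * q * y) = (a * q * y) * x + n.
    by rewrite -{2}(prednK x_gt0); nia.
  by rewrite modnMDl.
- by rewrite /= mulnDr leq_add // leq_mul2r; apply/orP; right; lia.
Qed.

(** Copies of [x] fill the gap between [n] and the small sum in its residue class. *)
Lemma coin_sum_large (x : nat) (b : seq nat) (n : nat) : 0 < x ->
  \big[gcdn/0]_(y <- x :: b) y = 1 -> x.-1 * sumn b <= n ->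
  exists c, coin_sum (x :: b) c n.
Proof.
move=> x_gt0; rewrite big_cons => g1 le_n.
have [|c [m [[s [sb <- _]] sn le_s]]] := @coin_sum_mod x b n x_gt0.
  by rewrite g1 dvd1n.
have le_sn : sumn s <= n := leq_trans le_s le_n.
have /dvdnP[q def_q] : x %| n - sumn s by rewrite -eqn_mod_dvd // sn.
exists (q + size s), (nseq q x ++ s); split.
- rewrite all_cat all_nseq /= inE eqxx orbT /=.
  by apply: sub_all sb => z /= zb; rewrite inE zb orbT.
- by rewrite sumn_cat sumn_nseq mulnC -def_q subnK.
- by rewrite size_cat size_nseq.
Qed.

Lemma leq_sumn (x : nat) (s : seq nat) : x \in s -> x <= sumn s.
Proof. by elim: s => //= y s IHs; rewrite inE => /orP[/eqP->|/IHs]; lia. Qed.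

Lemma size_coins_le (s : seq nat) : all (leq 1) s -> size s <= sumn s.
Proof. by elim: s => //= x s IHs /andP[x_gt0 /IHs]; lia. Qed.

Lemma coin_sum_complement (A : nat) (s : seq nat) : all (fun x => x <= A) s ->
  sumn [seq A - x | x <- s] + sumn s = size s * A.
Proof. by elim: s => //= x s IHs /andP[le_x /IHs]; rewrite mulSn; lia. Qed.

(** Used with [G] = g + 1 for the Frobenius number g; [G = 0] covers the case g = -1. *)
Lemma conductor_exists (P : nat -> Prop) (B : nat) : (forall n, B <= n -> P n) ->
  exists G, [/\ G <= B, forall n, G <= n -> P n & forall g, G = g.+1 -> ~ P g].
Proof.
elim: B => [|B IHB] PB; first by exists 0.
have [PBB|nPB] := classic (P B); last by exists B.+1; split=> // g [<-].
have [|G [leG PG nPG]] := IHB.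
  by move=> n; rewrite leq_eqVlt => /orP[/eqP<-//|/PB].
by exists G; split=> //; apply: leqW.
Qed.

(** * Stamp sums as complements of coin sums *)

Definition stamps (A : nat) (b : seq nat) : seq nat :=
  1 :: rcons (rev [seq A - x | x <- b]) A.

Lemma mem_stamps (A : nat) (b : seq nat) (x : nat) :
  (x \in stamps A b) = [|| x == 1, x == A | x \in [seq A - y | y <- b]].
Proof. by rewrite inE mem_rcons inE mem_rev. Qed.

(** Complementing reverses the order, hence the [rev]; the bounds on the coins keep the complements
    strictly between 1 and [A]. *)
Lemma sorted_stamps (A : nat) (b : seq nat) : 1 < A -> all (leq 1) b ->
  all (fun x => x < A.-1) b -> sorted ltn b -> sorted ltn (stamps A b).
Proof.
move=> A_gt1 b_gt0 b_lt; rewrite !sorted_pairwise; try exact: ltn_trans.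
move=> sb; rewrite /stamps /= -cats1 pairwise_cat /= all_cat /= A_gt1 !andbT allrel1r.
rewrite !all_rev !all_map; apply/and3P; split.
- by apply: sub_all b_lt => x /=; lia.
- by apply/allP => x xb /=; move/allP/(_ _ xb): b_gt0 => /=; lia.
- rewrite -(sorted_pairwise ltn_trans) rev_sorted.
  rewrite sorted_pairwise => [|? ? ? /=]; last by lia.
  rewrite pairwise_map; apply: (sub_in_pairwise (P := mem b)) sb; last exact/allP.
  by move=> x y /(allP b_lt) /= ? /(allP b_lt) /= ? /=; lia.
Qed.

Lemma stamp_number_complement (A h G : nat) (b : seq nat) :
  1 < A -> A ^ 2 <= h -> all (leq 1) b -> all (fun x => x < A.-1) b -> G <= A.-1 ->
  (forall n, G <= n -> exists c, coin_sum b c n) ->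
  (forall g, G = g.+1 -> ~ exists c, coin_sum b c g) ->
  stamp_number h (stamps A b) (h * A + 1 - G).
Proof.
move=> A_gt1 le_h b_gt0 b_lt G_lt above gap.
have stamps_le s : all (mem (stamps A b)) s -> all (fun x => x <= A) s.
  apply: sub_all => x; rewrite /= mem_stamps => /or3P[/eqP->|/eqP->|/mapP[y _ ->]] //; lia.
have hA : A <= h * A by rewrite leq_pmull //; nia.
split; first by lia.
  move=> /stamp_representableP[c le_c [s [ss sum_s size_s]]].
  have := coin_sum_complement (stamps_le s ss).
  rewrite sum_s size_s => def_c.
  (* For [G = 0] the target [h * A + 1] exceeds every sum of [h] stamps. Otherwise fewer than [h]
     stamps reach at most (h - 1) A, which is less than h A - g because g < A. *)
  case def_G : G => [|g]; first by have := leq_mul le_c (leqnn A); lia.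
  have c_h : c = h.
    by apply/eqP; rewrite eqn_leq le_c leqNgt; apply/negP => lt_c; nia.
  have sum_g : sumn [seq A - x | x <- s] = g by move: def_c; rewrite c_h; lia.
  (* Zeros come from the stamp [A] and are dropped; the stamp 1 would give [A - 1], which is larger
     than the whole sum [g]. *)
  apply: (gap _ def_G); pose t := [seq y <- [seq A - x | x <- s] | y != 0].
  exists (size t), t; split=> //; last first.
    by rewrite -sum_g /t; elim: {+}s => //= x r <-; case: eqP => //= ->.
  apply/allP => y; rewrite mem_filter => /andP[y_neq0 /[dup] ys /mapP[x xs def_y]].
  have le_y : y <= g.
    by rewrite -sum_g leq_sumn.
  move: (allP ss _ xs); rewrite /= mem_stamps => /or3P[/eqP x1|/eqP xA|/mapP[z zb x_z]].
  - by lia.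
  - by lia.
  - by move: (allP b_lt _ zb) => /= lt_z; rewrite (_ : y = z) //; lia.
move=> m m_gt0 nm; rewrite leqNgt; apply/negP => lt_m; apply: nm.
apply/stamp_representableP.
(* Below this threshold the quotient by [A] is at most h - A + 1 and the remainder at most A - 1,
   hence at most [h] stamps; from it on, h A - m is at most (A - 2) A. *)
have [small|large] := ltnP m ((h - A + 2) * A).
  exists (m %/ A + m %% A).
    have : m %/ A < h - A + 2 by rewrite ltn_divLR //; lia.
    have : m %% A < A by rewrite ltn_mod; lia.
    have : A <= h by nia.
    lia.
  exists (nseq (m %/ A) A ++ nseq (m %% A) 1).
  rewrite all_cat !all_nseq /= !mem_stamps !eqxx /= !orbT sumn_cat !sumn_nseq.
  by rewrite size_cat !size_nseq mulnC mul1n -divn_eq.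
have [|c [t [tb sum_t _]]] := above (h * A - m); first lia.
have t_gt0 : all (leq 1) t by apply: sub_all tb => x /(allP b_gt0).
have size_t : size t <= h.
  have : h * A - m <= h by nia.
  by rewrite -sum_t; apply: leq_trans (size_coins_le t_gt0).
have t_le : all (fun x => x <= A) t.
  by apply: sub_all tb => x /(allP b_lt) /=; lia.
(* The extra stamps [A] are the complements of void coins. *)
exists h => //; exists ([seq A - x | x <- t] ++ nseq (h - size t) A); split.
- rewrite all_cat all_nseq /= mem_stamps eqxx !orbT andbT.
  rewrite all_map; apply: sub_all tb => x xb.
  by rewrite /= mem_stamps (map_f (fun y => A - y)) ?orbT.
- have := coin_sum_complement t_le; rewrite sumn_cat sumn_nseq mulnBr sum_t.
  have := leq_mul size_t (leqnn A); lia.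
- by rewrite size_cat size_map size_nseq subnKC.
Qed.

(** For [G = 0] the value is -1, as no negative integer is representable. *)
Lemma frobenius_number_conductor (G : nat) (b : seq nat) :
  (forall n, G <= n -> exists c, coin_sum b c n) ->
  (forall g, G = g.+1 -> ~ exists c, coin_sum b c g) ->
  frobenius_number b (Posz G - 1)%R.
Proof.
move=> above gap; split.
  case def_G : G => [|g]; first by move=> [x].
  by rewrite intS GRing.addrAC GRing.subrr GRing.add0r => /representableP /(gap _ def_G).
case=> [n|n] nr; last by lia.
have [le_n|lt_n] := leqP G n; last by lia.
by case: nr; apply/representableP/above.
Qed.

(** * Binary expansions *)

Lemma size_bits (n : nat) : size (bits n) = (trunc_log 2 n).+1.
Proof. by rewrite size_mkseq. Qed.

Lemma ltn_bits (n : nat) : n < 2 ^ size (bits n).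
Proof. by rewrite size_bits trunc_log_ltn. Qed.

Lemma encode_cons (n : nat) (s : seq nat) :
  encode (n :: s) = [seq Some x | x <- bits n] ++ None :: encode s.
Proof. by rewrite /encode /= cat_rcons. Qed.

Lemma encode_cat (s t : seq nat) : encode (s ++ t) = encode s ++ encode t.
Proof. by rewrite /encode map_cat flatten_cat. Qed.

Lemma encode1 (n : nat) : encode [:: n] = rcons [seq Some x | x <- bits n] None.
Proof. by rewrite /encode /= cats0. Qed.

Lemma size_encode_cons (n : nat) (s : seq nat) :
  size (encode (n :: s)) = size (bits n) + (size (encode s)).+1.
Proof. by rewrite encode_cons size_cat size_map. Qed.

Lemma sumn_lt_encode (s : seq nat) : sumn s < 2 ^ size (encode s).
Proof.
elim: s => // n s IHs; rewrite [sumn _]/= size_encode_cons addnS expnS expnD.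
have := ltn_bits n; nia.
Qed.

Lemma size_bits_encode (n : nat) (s : seq nat) :
  n \in s -> size (bits n) < size (encode s).
Proof.
elim: s => // m s IHs; rewrite size_encode_cons inE => /orP[/eqP->|/IHs]; lia.
Qed.

Lemma size_le_encode (s : seq nat) : size s <= size (encode s).
Proof. by elim: s => // n s; rewrite size_encode_cons /=; lia. Qed.

(** Subtracting from all ones never borrows, so it commutes with dropping the [i] low digits. *)
Lemma divn_ones_subr (L i n : nat) : n < 2 ^ L -> i <= L ->
  ((2 ^ L).-1 - n) %/ 2 ^ i = (2 ^ (L - i)).-1 - n %/ 2 ^ i.
Proof.
move=> lt_n le_i; have pL : 2 ^ L = 2 ^ (L - i) * 2 ^ i by rewrite -expnD subnK.
have i_gt0 : 0 < 2 ^ i by rewrite expn_gt0.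
have lt_q : n %/ 2 ^ i < 2 ^ (L - i) by rewrite ltn_divLR // -pL.
have lt_r : n %% 2 ^ i < 2 ^ i by rewrite ltn_mod.
have -> : (2 ^ L).-1 - n
    = ((2 ^ (L - i)).-1 - n %/ 2 ^ i) * 2 ^ i + ((2 ^ i).-1 - n %% 2 ^ i).
  by rewrite {1}(divn_eq n (2 ^ i)) pL; nia.
rewrite divnMDl // [X in _ + X]divn_small ?addn0 //.
by lia.
Qed.

Lemma odd_ones_subr (L i n : nat) : n < 2 ^ L -> i < L ->
  odd (((2 ^ L).-1 - n) %/ 2 ^ i) = ~~ odd (n %/ 2 ^ i).
Proof.
move=> lt_n lt_i; rewrite (divn_ones_subr lt_n (ltnW lt_i)).
have : n %/ 2 ^ i < 2 ^ (L - i).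
  by rewrite ltn_divLR ?expn_gt0 // -expnD subnK // ltnW.
rewrite -[L - i]prednK ?subn_gt0 // expnS => lt_q.
rewrite oddB; last lia.
have -> : (2 * 2 ^ (L - i).-1).-1 = (2 * (2 ^ (L - i).-1).-1).+1 by lia.
by rewrite oddS oddM addTb.
Qed.

(** The strict bound leaves at least one padding digit, so the top digit is 1 and the expansion has
    exactly [L] digits. *)
Lemma bits_ones_subr (L n : nat) : size (bits n) < L ->
  bits ((2 ^ L).-1 - n) = [seq ~~ x | x <- bits n] ++ nseq (L - size (bits n)) true.
Proof.
move=> lt_L; have lt_n := ltn_bits n.
have lt_nL : n < 2 ^ L.-1.
  by apply: leq_trans lt_n _; rewrite leq_exp2l //; lia.
have pL : 2 ^ L = 2 * 2 ^ L.-1 by rewrite -expnS prednK //; lia.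
have log_L : trunc_log 2 ((2 ^ L).-1 - n) = L.-1.
  by apply: trunc_log_eq; rewrite // prednK; lia.
apply: (@eq_from_nth _ true) => [|i].
  by rewrite size_bits log_L size_cat size_map size_nseq; lia.
rewrite size_bits log_L prednK => [lt_i|]; last lia.
rewrite nth_mkseq ?log_L; last lia.
rewrite odd_ones_subr //; last lia.
rewrite nth_cat size_map; case: ltnP => [lt_ib|le_bi].
  by rewrite (nth_map true) // nth_mkseq // -size_bits.
rewrite nth_nseq if_same divn_small //.
by apply: leq_trans lt_n _; rewrite leq_exp2l.
Qed.

Lemma bits_ones (L : nat) : 0 < L -> bits (2 ^ L).-1 = nseq L true.
Proof.
move=> L_gt0; have pL : 2 ^ L = 2 * 2 ^ L.-1 by rewrite -expnS prednK.
have p_gt0 : 0 < 2 ^ L.-1 by rewrite expn_gt0.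
have log_L : trunc_log 2 (2 ^ L).-1 = L.-1.
  by apply: trunc_log_eq; rewrite // [L.-1.+1]prednK //; lia.
apply: (@eq_from_nth _ true) => [|i].
  by rewrite size_bits log_L size_nseq prednK.
rewrite size_bits log_L prednK // => lt_i.
rewrite nth_mkseq ?log_L ?prednK // -[(2 ^ L).-1]subn0 odd_ones_subr ?expn_gt0 //.
by rewrite div0n nth_nseq if_same.
Qed.

(** * The reduction and its correctness *)

Definition reduction (b : seq nat) : nat * seq nat :=
  let L := size (encode b) in ((2 ^ (2 * L)).-1, stamps (2 ^ L).-1 b).

Lemma reduction_correct (b : seq nat) : frobenius_input b ->
  let h := (reduction b).1 in
  let a := (reduction b).2 in
  [/\ 0 < h, size a = size b + 2, nth 0 a 0 = 1, sorted ltn a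
    & exists (g : int) (N : nat),
        [/\ frobenius_number b g, stamp_number h a N
          & g = (Posz h * Posz (nth 0%N a (size b + 1)) - Posz N)%R]].
Proof.
case=> b_gt0 b_sorted b_gcd /=; set L := size (encode b); set A := (2 ^ L).-1.
have L_gt1 : 1 < L.
  rewrite /L; case: b b_gcd {L A b_gt0 b_sorted} => [|x b _]; first by rewrite big_nil.
  by rewrite size_encode_cons size_bits; lia.
have p_gt0 : 1 < 2 ^ L.-1 by rewrite (ltn_exp2l 0) //; lia.
have pL : 2 ^ L = 2 * 2 ^ L.-1 by rewrite -expnS prednK //; lia.
have b_lt : all (fun x => x < A.-1) b.
  apply/allP => x /size_bits_encode lt_x.
  have : 2 ^ size (bits x) <= 2 ^ L.-1 by rewrite leq_exp2l //; lia.
  have := ltn_bits x; rewrite /A; lia.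
have le_h : A ^ 2 <= (2 ^ (2 * L)).-1 by rewrite mulnC expnM /A; nia.
have A_gt1 : 1 < A by rewrite /A; lia.
have [|G [le_G above gap]] :=
    @conductor_exists (fun n => exists c, coin_sum b c n) A.-1.
  move=> n le_n; case def_b : b b_gt0 b_gcd => [|x b'] /=; first by rewrite big_nil.
  case/andP=> x_gt0 _ b_gcd; apply: coin_sum_large => //; apply: leq_trans le_n.
  (* The separator after [x] takes one of the [L] letters, so [x.-1 * sumn b'] is less than
     [2 ^ L.-1], which is at most [A.-1]. *)
  have := ltn_bits x; have := sumn_lt_encode b'.
  have : 2 ^ L.-1 = 2 ^ size (bits x) * 2 ^ size (encode b').
    by rewrite -expnD /L def_b size_encode_cons addnS.
  rewrite /A; nia.
have size_a : size (stamps A b) = size b + 2.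
  by rewrite /= size_rcons size_rev size_map addn2.
have last_a : nth 0 (stamps A b) (size b + 1) = A.
  by rewrite addn1 /= nth_rcons size_rev size_map ltnn eqxx.
split=> //; first by nia.
  exact: sorted_stamps.
exists (Posz G - 1)%R, ((2 ^ (2 * L)).-1 * A + 1 - G); split.
- exact: frobenius_number_conductor above gap.
- exact: stamp_number_complement.
(* This makes the truncated subtraction of [G] exact. *)
- rewrite last_a; have : A <= (2 ^ (2 * L)).-1 * A by rewrite leq_pmull //; nia.
  lia.
Qed.

(** * The Turing machine *)

(* [Scan] writes [L] marks on the counter tape and, together with [Back], the
   [2 L] ones of [h]; [One] and [OneSep] write the stamp 1.  Each number, the last
   one first, is entered from its separator ([Skip]), rewound to its low bit
   ([Find]), complemented ([Copy]) and extended to [L] digits ([Pad]), after which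
   both heads return ([Rewind], [Skip]); [Last] writes [A]. *)
Inductive phase :=
  Scan | Back | One | OneSep | Skip | Find | Copy | Pad | Rewind | Last | Halt.

Definition phases : seq phase :=
  [:: Scan; Back; One; OneSep; Skip; Find; Copy; Pad; Rewind; Last; Halt].

Definition phase_code (q : phase) : 'I_11 :=
  inord match q with
  | Scan => 0 | Back => 1 | One => 2 | OneSep => 3 | Skip => 4 | Find => 5
  | Copy => 6 | Pad => 7 | Rewind => 8 | Last => 9 | Halt => 10
  end.

Lemma phase_codeK : cancel phase_code (fun i => nth Halt phases i).
Proof. by case; rewrite /phase_code inordK. Qed.

HB.instance Definition _ := Finite.copy phase (can_type phase_codeK).

(** The separator doubles as counter mark, so no work symbols are required. *)
Definition mark : symbol void := Some (inl None).

(* Next phase, input head move, counter action, and symbol appended to the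
   output; the input tape is read-only. *)
Definition transition (q : phase) (x y : symbol void) :
    phase * move * (symbol void * move) * option io :=
  match q with
  | Scan => if x is Some _ then (Scan, MoveR, (mark, MoveR), Some (Some true))
            else (Back, MoveL, (None, MoveL), None)
  | Back => if y is Some _ then (Back, Stay, (y, MoveL), Some (Some true))
            else (One, Stay, (y, MoveR), Some None)
  | One => (OneSep, Stay, (y, Stay), Some (Some true))
  | OneSep => (Skip, Stay, (y, Stay), Some None)
  | Skip => match x with
            | Some (inl (Some _)) => (Skip, MoveL, (y, Stay), None)
            | Some _ => (Find, MoveL, (y, Stay), None)
            | None => (Last, Stay, (y, Stay), None)
            end
  | Find => if x is Some (inl (Some _)) then (Find, MoveL, (y, Stay), None)
            else (Copy, MoveR, (y, Stay), None)
  | Copy => if x is Some (inl (Some c))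
            then (Copy, MoveR, (y, MoveR), Some (Some (~~ c)))
            else (Pad, Stay, (y, Stay), None)
  | Pad => if y is Some _ then (Pad, Stay, (y, MoveR), Some (Some true))
           else (Rewind, MoveL, (y, MoveL), Some None)
  | Rewind => if y is Some _ then (Rewind, Stay, (y, MoveL), None)
              else (Skip, Stay, (y, MoveR), None)
  | Last => if y is Some _ then (Last, Stay, (y, MoveR), Some (Some true))
            else (Halt, Stay, (y, Stay), Some None)
  | Halt => (Halt, Stay, (y, Stay), None)
  end.

Definition output_action (o : option io) : symbol void * move :=
  if o is Some x then (Some (inl x), MoveR) else (None, Stay).

Definition reduction_delta (q : phase) (s : 3.-tuple (symbol void)) :
    phase * 3.-tuple (symbol void * move) :=
  let: (q', m, a, o) := transition q (tnth s ord0) (tnth s (inord 1)) in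
  (q', [tuple (tnth s ord0, m); a; output_action o]).

Definition reduction_machine : TM :=
  @MkTM phase void 2 Scan (fun q => if q is Halt then true else false)
        reduction_delta.

Definition tape_at (l r : seq (symbol void)) : tape void :=
  MkTape l (head None r) (behead r).

(* The head has just moved left from the first cell of [r]. *)
Definition tape_left (l r : seq (symbol void)) : tape void :=
  MkTape (behead l) (head None l) r.

(** The output head always scans the blank just after [w], so [w] determines the third tape. *)
Definition cfg (q : phase) (t0 t1 : tape void) (w : seq io) :
    config reduction_machine :=
  (q, [tuple t0; t1; tape_at (rev (word_cells void w)) [::]]).

Lemma step_cfg q t0 t1 w : q <> Halt ->
  step (cfg q t0 t1 w) =
  let: (q', m, a, o) := transition q (tcur t0) (tcur t1) in
  cfg q' (move_tape m t0) (write_move t1 a) (oapp (rcons w) w o).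
Proof.
move=> qH; rewrite /step /= ifF; last by case: q qH.
rewrite /reduction_delta !tnth_mktuple.
have -> : tnth [tuple t0; t1; tape_at (rev (word_cells void w)) [::]] (inord 1) = t1.
  by rewrite (tnth_nth t0) inordK.
rewrite /=; case: transition => [[[q' m] a] o]; congr pair.
apply: eq_from_tnth => i; rewrite tnth_mktuple !(tnth_nth t0) !(tnth_nth (None, Stay)).
case: i => [[|[|[|//]]] lt_i] //=.
- by case: t0.
- case: o => [x|] //=.
  by rewrite /write_move /= /word_cells map_rcons rev_rcons.
Qed.

(** An upper bound on the time, so that costs depending on a digit count can be rounded up. *)
Definition run (n : nat) (c c' : config reduction_machine) : Prop :=
  exists2 t, t <= n & iter t (@step reduction_machine) c = c'.

Lemma run_refl n c : run n c c.
Proof. by exists 0. Qed.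

Lemma run_trans m n c1 c2 c3 : run m c1 c2 -> run n c2 c3 -> run (m + n) c1 c3.
Proof.
move=> [t le_t <-] [u le_u <-]; exists (u + t); last by rewrite iterD.
by rewrite addnC leq_add.
Qed.

Lemma run_step n c1 c2 c3 : step c1 = c2 -> run n c2 c3 -> run n.+1 c1 c3.
Proof. by move=> s12; apply: (@run_trans 1); exists 1. Qed.

(** * Effect and cost of each phase *)

Lemma cat_nseqS (T : Type) (n : nat) (x : T) (s : seq T) :
  nseq n x ++ x :: s = nseq n.+1 x ++ s.
Proof. by elim: n => //= n ->. Qed.

Definition bit_cells (u : seq bool) : seq (symbol void) :=
  word_cells void [seq Some c | c <- u].

(** Both heads step back from the blank they stopped on, which is now a listed cell: hence
    [[:: None]]. *)
Lemma run_scan v l n w :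
  run (size v).+1
    (cfg Scan (tape_at l (word_cells void v)) (tape_at (nseq n mark) [::]) w)
    (cfg Back (tape_left (rev (word_cells void v) ++ l) [:: None])
       (tape_left (nseq (size v + n) mark) [:: None])
       (w ++ nseq (size v) (Some true))).
Proof.
elim: v l n w => [|x v IHv] l n w.
  by rewrite cats0; exists 1; rewrite //= step_cfg.
rewrite [size _ + n]addSnnS /= rev_cons cat_rcons -[w ++ _]cat_rcons.
by apply: run_step (IHv _ n.+1 _); rewrite step_cfg.
Qed.

Lemma run_back (l r : seq (symbol void)) t0 n w : behead l = [::] -> head None l = None ->
  run n.+1 (cfg Back t0 (tape_left (nseq n mark ++ l) r) w)
    (cfg One t0 (tape_at [:: None] (nseq n mark ++ r))
       (w ++ rcons (nseq n (Some true)) None)).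
Proof.
case: t0 => tl tc tr l0 l1; elim: n r w => [|n IHn] r w.
  by exists 1; rewrite //= step_cfg //= l1 /write_move /= l0 cats1.
rewrite -(cat_nseqS n mark r) /= -[w ++ _]cat_rcons.
by apply: run_step (IHn _ _); rewrite step_cfg.
Qed.

Lemma run_rewind (l r : seq (symbol void)) t0 n w : behead l = [::] -> head None l = None ->
  run n.+1 (cfg Rewind t0 (tape_left (nseq n mark ++ l) r) w)
    (cfg Skip t0 (tape_at [:: None] (nseq n mark ++ r)) w).
Proof.
case: t0 => tl tc tr l0 l1; elim: n r => [|n IHn] r.
  by exists 1; rewrite //= step_cfg //= l1 /write_move /= l0.
rewrite -(cat_nseqS n mark r) /=.
by apply: run_step (IHn _); rewrite step_cfg.
Qed.

Lemma run_skip u l r t1 w :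
  run (size u) (cfg Skip (tape_left (rev (bit_cells u) ++ l) r) t1 w)
    (cfg Skip (tape_left l (bit_cells u ++ r)) t1 w).
Proof.
case: t1 => tl tc tr; elim/last_ind: u r => [|u c IHu] r; first exact: run_refl.
rewrite size_rcons /bit_cells /word_cells !map_rcons rev_rcons cat_rcons.
by apply: run_step (IHu _); rewrite step_cfg.
Qed.

(** The hypothesis allows the previous separator or, for the first number, the blank left of the
    input. *)
Lemma run_find u l r t1 w :
  (if head None l is Some (inl (Some _)) then false else true) ->
  run (size u).+1 (cfg Find (tape_left (rev (bit_cells u) ++ l) r) t1 w)
    (cfg Copy (tape_at (head None l :: behead l) (bit_cells u ++ r)) t1 w).
Proof.
case: t1 => tl tc tr l_nb; elim/last_ind: u r => [|u c IHu] r.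
  exists 1; rewrite //= step_cfg //=.
  by case: (head None l) l_nb => [[[]|]|].
rewrite size_rcons /bit_cells /word_cells !map_rcons rev_rcons cat_rcons.
by apply: run_step (IHu _); rewrite step_cfg.
Qed.

(** Both heads advance together, so the marks still ahead count the padding digits. *)
Lemma run_copy u l r (l1 r1 : seq (symbol void)) w :
  run (size u).+1
    (cfg Copy (tape_at l (bit_cells u ++ mark :: r))
       (tape_at l1 (nseq (size u) mark ++ r1)) w)
    (cfg Pad (tape_at (rev (bit_cells u) ++ l) (mark :: r))
       (tape_at (nseq (size u) mark ++ l1) r1) (w ++ [seq Some (~~ c) | c <- u])).
Proof.
elim: u l l1 w => [|c u IHu] l l1 w; first by exists 1; rewrite //= step_cfg // cats0.
rewrite [size _]/= -(cat_nseqS _ mark l1) /= -[w ++ _]cat_rcons rev_cons cat_rcons.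
by apply: run_step (IHu _ _ _); rewrite step_cfg.
Qed.

Lemma run_pad l r (l1 : seq (symbol void)) n w :
  run n.+1
    (cfg Pad (tape_at l (mark :: r)) (tape_at l1 (nseq n mark ++ [:: None])) w)
    (cfg Rewind (tape_left l (mark :: r)) (tape_left (nseq n mark ++ l1) [:: None])
       (w ++ rcons (nseq n (Some true)) None)).
Proof.
elim: n l1 w => [|n IHn] l1 w; first by exists 1; rewrite //= step_cfg // cats1.
rewrite -(cat_nseqS _ mark l1) /= -[w ++ _]cat_rcons.
by apply: run_step (IHn _ _); rewrite step_cfg.
Qed.

Lemma run_last t0 l1 n w :
  exists t1, run n.+1
    (cfg Last t0 (tape_at l1 (nseq n mark ++ [:: None])) w)
    (cfg Halt t0 t1 (w ++ rcons (nseq n (Some true)) None)).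
Proof.
case: t0 => tl tc tr; elim: n l1 w => [|n IHn] l1 w.
  by exists (tape_at l1 [:: None]), 1; rewrite //= step_cfg // cats1.
have [t1 IH] := IHn (mark :: l1) (rcons w (Some true)); exists t1.
rewrite /= -[w ++ _]cat_rcons.
by apply: run_step IH; rewrite step_cfg.
Qed.

(** The blanks on both sides are listed because the head has visited them; each round then restores
    exactly this tape. *)
Definition counter (L : nat) : tape void :=
  tape_at [:: None] (nseq L mark ++ [:: None]).

Definition complement_code (L : nat) (u : seq bool) : seq io :=
  rcons ([seq Some (~~ c) | c <- u] ++ nseq (L - size u) (Some true)) None.

Lemma run_number L u l r w : size u <= L ->
  (if head None l is Some (inl (Some _)) then false else true) ->
  run (4 * L + 5)
    (cfg Skip (tape_at (rev (bit_cells u) ++ l) (mark :: r)) (counter L) w)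
    (cfg Skip (tape_left l (bit_cells u ++ mark :: r)) (counter L)
       (w ++ complement_code L u)).
Proof.
move=> le_u l_nb.
(* One step off the separator, then [Find], [Copy], [Pad], [Rewind] and [Skip]; the last summand is
   slack. *)
have -> : 4 * L + 5 = ((size u).+1 + ((size u).+1 + ((L - size u).+1 +
    (L.+1 + (size u + (2 * L - 2 * size u)))))).+1 by lia.
apply: run_step; first by rewrite step_cfg.
apply: run_trans (run_find _ _ _ _ l_nb) _.
have -> : write_move (counter L) (tcur (counter L), Stay)
    = tape_at [:: None] (nseq (size u) mark ++ (nseq (L - size u) mark ++ [:: None])).
  by rewrite catA -nseqD subnKC // /counter; case: (nseq _ _ ++ _).
apply: run_trans (run_copy _ _ _ _ _ _) _.
apply: run_trans (run_pad _ _ _ _ _) _.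
rewrite catA -nseqD subnK //.
apply: run_trans (@run_rewind [:: None] _ _ _ _ erefl erefl) _.
apply: run_trans (run_skip _ _ _ _ _) _.
rewrite /complement_code rcons_cat -catA.
exact: run_refl.
Qed.

Lemma word_cells_cat (v w : seq io) :
  word_cells void (v ++ w) = word_cells void v ++ word_cells void w.
Proof. exact: map_cat. Qed.

Lemma word_cells_encode1 n :
  word_cells void (encode [:: n]) = rcons (bit_cells (bits n)) mark.
Proof. by rewrite encode1 /word_cells map_rcons. Qed.

(** Induction from the end of [b], where the head starts; this yields the reversed order used in
    [stamps]. *)
Lemma run_numbers L b r w : all (fun n => size (bits n) <= L) b ->
  exists r', run (size b * (4 * L + 5))
    (cfg Skip (tape_left (rev (word_cells void (encode b))) r) (counter L) w)
    (cfg Skip (tape_left [::] r') (counter L)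
       (w ++ flatten [seq complement_code L (bits n) | n <- rev b])).
Proof.
elim/last_ind: b r w => [|b n IHb] r w.
  by move=> _; exists r; rewrite cats0; apply: run_refl.
rewrite all_rcons => /andP[le_n le_b].
pose w' := w ++ complement_code L (bits n).
pose l := rev (word_cells void (encode b)).
have [r' IH] := IHb (bit_cells (bits n) ++ mark :: r) w' le_b.
exists r'; rewrite rev_rcons map_cons -[flatten (_ :: _)]/(_ ++ flatten _) catA size_rcons mulSn.
apply: run_trans IH.
rewrite -cats1 encode_cat word_cells_cat.
rewrite word_cells_encode1 -cats1 catA rev_cat rev_cat.
apply: (@run_number L (bits n) l r w) => //.
rewrite /l; case: (lastP b) => // b' n'.
by rewrite -cats1 encode_cat word_cells_cat
  word_cells_encode1 rev_cat rev_rcons.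
Qed.

(** * The encoded output and the total running time *)

Lemma encode_ones L : 0 < L ->
  encode [:: (2 ^ L).-1] = rcons (nseq L (Some true)) None.
Proof. by move=> L_gt0; rewrite encode1 bits_ones // map_nseq. Qed.

Lemma encode_complement L n : size (bits n) < L ->
  encode [:: (2 ^ L).-1 - n] = complement_code L (bits n).
Proof.
by move=> lt_n; rewrite encode1 bits_ones_subr // map_cat map_nseq -map_comp.
Qed.

Lemma encode_reduction b : let L := size (encode b) in 0 < L ->
  encode ((reduction b).1 :: (reduction b).2) =
  rcons (nseq (L + L) (Some true)) None ++ [:: Some true; None] ++
  flatten [seq complement_code L (bits n) | n <- rev b] ++
  rcons (nseq L (Some true)) None.
Proof.
move=> L L_gt0; rewrite -(encode_ones L_gt0) -(@encode_ones (L + L)) ?addn_gt0 ?L_gt0 //.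
rewrite /reduction -/L mulSn mul1n /stamps -cats1.
rewrite -cat1s encode_cat; congr (_ ++ _).
rewrite -cat1s encode_cat; congr (_ ++ _).
rewrite encode_cat; congr (_ ++ _).
rewrite /encode -map_rev -map_comp; congr flatten; apply/eq_in_map => n.
rewrite mem_rev => /size_bits_encode lt_n.
by rewrite -encode_complement // encode1.
Qed.

Lemma run_reduction b : 0 < size (encode b) ->
  let L := size (encode b) in
  exists t0 t1, run (4 * L ^ 2 + 8 * L + 6) (init reduction_machine (encode b))
    (cfg Halt t0 t1 (encode ((reduction b).1 :: (reduction b).2))).
Proof.
move=> L_gt0 L.
set w := rcons (nseq (L + L) (Some true)) None ++ [:: Some true; None].
have [|r' loop] := @run_numbers L b [:: None] w.
  by apply/allP => n /size_bits_encode /ltnW.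
pose w' := w ++ flatten [seq complement_code L (bits n) | n <- rev b].
have [t1 final] := run_last (tape_left [::] r') [:: None] L w'.
exists (tape_left [::] r'), t1.
rewrite encode_reduction // -/L catA -/w catA -/w'.
(* [Scan], [Back], the stamp 1, one round per number, the switch to [Last], and [Last];
   [size b <= L] makes the total quadratic. *)
have le_T : L.+1 + (L.+1 + (2 + (size b * (4 * L + 5) + (1 + L.+1))))
    <= 4 * L ^ 2 + 8 * L + 6.
  have := size_le_encode b; rewrite -/L; nia.
suff [t le_t run_t] : run (L.+1 + (L.+1 + (2 + (size b * (4 * L + 5) + (1 + L.+1)))))
    (init reduction_machine (encode b))
    (cfg Halt (tape_left [::] r') t1 (w' ++ rcons (nseq L (Some true)) None)).
  by exists t => //; apply: leq_trans le_t le_T.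
have -> : init reduction_machine (encode b) =
    cfg Scan (tape_at [::] (word_cells void (encode b))) (tape_at (nseq 0 mark) [::]) [::].
  congr pair; apply: eq_from_tnth => i; rewrite tnth_mktuple.
  by rewrite (tnth_nth (blank_tape void)); case: i => [[|[|[|//]]] lt_i].
apply: run_trans (run_scan _ _ _ _) _; rewrite cats0 addn0 cat0s.
rewrite -[nseq _ mark]cats0.
apply: run_trans (@run_back [::] _ _ _ _ erefl erefl) _.
apply: (@run_trans 2) (run_trans loop (run_trans _ final)).
  exists 2; rewrite //= !step_cfg //= /w nseqD -rcons_cat -!cats1 -!catA.
  by rewrite /counter; case: (nseq _ _ ++ _).
by exists 1; rewrite //= step_cfg.
Qed.

Theorem mainTheorem2 :
  exists f : seq nat -> nat * seq nat,
    polytime_computable frobenius_input (fun b => (f b).1 :: (f b).2) /\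
    forall b : seq nat, frobenius_input b ->
      let h := (f b).1 in
      let a := (f b).2 in
      [/\ 0 < h, size a = size b + 2, nth 0 a 0 = 1, sorted ltn a
        & exists (g : int) (N : nat),
            [/\ frobenius_number b g, stamp_number h a N
              & g = (Posz h * Posz (nth 0%N a (size b + 1)) - Posz N)%R]].
Proof.
exists reduction; split; last exact: reduction_correct.
exists reduction_machine, (4%N%:P * 'X^2 + 8%N%:P * 'X + 6%N%:P)%R => b [_ _ b_gcd].
have L_gt0 : 0 < size (encode b).
  case: b b_gcd => [|x b _]; first by rewrite big_nil.
  by rewrite size_encode_cons size_bits.
have [t0 [t1 [t le_t def_t]]] := run_reduction L_gt0.
exists t; first by rewrite !hornerD !hornerM !hornerC !hornerX.
rewrite /computes_within def_t; split=> //.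
(* The single trailing blank is the cell under the output head. *)
by exists 0, 1; rewrite /= revK.
Qed.
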